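(* Consider the optimistic bilevel optimization problem (OBOP), its Lagrange dual reformulation (LD), and the mapping $K_\ell$, all as defined in the context. (a) Let $(\bar x,\bar y)\in\mathbb{R}^n\times\mathbb{R}^m$ be a global minimizer of (OBOP). Then, for each $\bar u\in K_\ell(\bar x,\bar y)$, the triplet $(\bar x,\bar y,\bar u)$ is a global minimizer of (LD). (b) Let $(\bar x,\bar y,\bar u)\in\mathbb{R}^n\times\mathbb{R}^m\times\mathbb{R}^p$ be a global minimizer of (LD). Assume that, for each $x\in X\cap\operatorname{dom}\Psi$, GCQ holds for the lower-level problem $(P(x))$ at all points of $\Psi(x)$. Then $(\bar x,\bar y)$ is a global minimizer of (OBOP).
   Context: Let $f\colon\mathbb{R}^n\times\mathbb{R}^m\to\mathbb{R}$ and $g\colon\mathbb{R}^n\times\mathbb{R}^m\to\mathbb{R}^p$ be twice continuously differentiable, $F\colon\mathbb{R}^n\times\mathbb{R}^m\to\mathbb{R}$ continuously differentiable, and $X\subset\mathbb{R}^n$ nonempty and closed. For each $x\in X$, the functions $f(x,\cdot),g_1(x,\cdot),\ldots,g_p(x,\cdot)$ are convex. Vector inequalities are componentwise. Lower-level problem $(P(x))$: $\min_y\{f(x,y)\mid g(x,y)\le 0\}$. Its value function is $\varphi(x):=\inf_y\{f(x,y)\mid g(x,y)\le 0\}\in\mathbb{R}\cup\{\pm\infty\}$, and its solution mapping is $\Psi(x):=\{y\in\mathbb{R}^m\mid g(x,y)\le 0,\ f(x,y)\le\varphi(x)\}$, with $\operatorname{dom}\Psi:=\{x\mid\Psi(x)\neq\emptyset\}$.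 (OBOP): $\min_{x,y}\{F(x,y)\mid x\in X,\ y\in\Psi(x)\}$. Lower-level Lagrangian: $L(x,y,u):=f(x,y)+u^\top g(x,y)$. Lagrange value function: $\psi_\ell(x,u):=\inf_y\{L(x,y,u)\mid y\in\mathbb{R}^m\}$ if $u\ge 0$, and $\psi_\ell(x,u):=-\infty$ otherwise. (LD): $\min_{x,y,u}\{F(x,y)\mid x\in X,\ g(x,y)\le 0,\ u\ge 0,\ f(x,y)\le\psi_\ell(x,u)\}$. $K_\ell\colon\mathbb{R}^n\times\mathbb{R}^m\rightrightarrows\mathbb{R}^p$ is $K_\ell(x,y):=\{u\in\mathbb{R}^p\mid g(x,y)\le 0,\ u\ge 0,\ f(x,y)\le\psi_\ell(x,u)\}$. GCQ (as defined here) holds for $(P(x))$ at a point $y$ with $g(x,y)\le 0$ if the tangent cone $T(y)$ to $\Gamma(x):=\{y'\in\mathbb{R}^m\mid g(x,y')\le 0\}$ at $y$ satisfies $T(y)=\{d\in\mathbb{R}^m\mid \nabla_y g_i(x,y)^\top d\le 0\ \text{for all } i \text{ with } g_i(x,y)=0\}$, where $T(y)$ is the set of all $d$ for which there exist $y^k\in\Gamma(x)$ and $t_k>0$ with $y^k\to y$, $t_k\downarrow 0$, $(y^k-y)/t_k\to d$. *)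

(* Defs.v *)
From mathcomp Require Import all_boot all_order all_algebra.
From mathcomp Require Import all_classical all_reals all_analysis.

Set Implicit Arguments.
Unset Strict Implicit.
Unset Printing Implicit Defensive.

Import Order.TTheory GRing.Theory Num.Theory.
Import numFieldNormedType.Exports.

Local Open Scope classical_set_scope.
Local Open Scope ring_scope.

(* For finite-dimensional V this is the usual class C^k: the map p |-> 'd h p
   is C^(k-1) for the operator norm iff each p |-> 'd h p v is. *)
Fixpoint class_C (R : realType) (V W : normedModType R) (k : nat)
    (h : V -> W) : Prop :=
  match k with
  | 0 => continuous h
  | k'.+1 => (forall p, differentiable h p) /\
             (forall v, class_C k' (fun p => 'D_v h p))
  end.

Definition global_minimizer (R : realType) (T : Type)
    (F : T -> R) (S : set T) (z : T) : Prop :=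
  S z /\ forall z', S z' -> F z <= F z'.

Section Vectors.
Context {R : realType}.

Definition lev (k : nat) (v w : 'rV[R]_k) : Prop :=
  forall i, v 0 i <= w 0 i.

Definition dot (k : nat) (v w : 'rV[R]_k) : R := \sum_i v 0 i * w 0 i.

Definition gradient (k : nat) (h : 'rV[R]_k -> R) (y : 'rV[R]_k) : 'rV[R]_k :=
  \row_j 'D_(delta_mx 0 j) h y.

Definition tangent_cone (k : nat) (A : set 'rV[R]_k) (y : 'rV[R]_k) :
    set 'rV[R]_k :=
  [set d | exists (ys : nat -> 'rV[R]_k) (t : nat -> R),
    [/\ forall i, A (ys i) /\ 0 < t i,
        ys @ \oo --> y,
        t @ \oo --> 0 &
        (t i)^-1 *: (ys i - y) @[i --> \oo] --> d]].

End Vectors.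

Section Bilevel.
Context {R : realType} {n m p : nat}.
Implicit Types (f : 'rV[R]_n * 'rV[R]_m -> R)
  (g : 'rV[R]_n * 'rV[R]_m -> 'rV[R]_p) (X : set 'rV[R]_n)
  (x : 'rV[R]_n) (y : 'rV[R]_m) (u : 'rV[R]_p).

Definition lower_feasible g x : set 'rV[R]_m := [set y | lev (g (x, y)) 0].

Definition value_fun f g x : \bar R :=
  ereal_inf [set (f (x, y))%:E | y in lower_feasible g x].

Definition solution_map f g x : set 'rV[R]_m :=
  [set y | lev (g (x, y)) 0 /\ ((f (x, y))%:E <= value_fun f g x)%E].

Definition dom_solution_map f g : set 'rV[R]_n :=
  [set x | solution_map f g x !=set0].

Definition OBOP_feasible f g X : set ('rV[R]_n * 'rV[R]_m) :=
  [set z | X z.1 /\ solution_map f g z.1 z.2].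

Definition lagrangian f g x y u : R := f (x, y) + dot u (g (x, y)).

Definition lagrange_value_fun f g x u : \bar R :=
  if `[< lev 0 u >]
  then ereal_inf [set (lagrangian f g x y u)%:E | y in [set: 'rV[R]_m]]
  else -oo%E.

Definition LD_feasible f g X : set ('rV[R]_n * 'rV[R]_m * 'rV[R]_p) :=
  [set z | let: (x, y, u) := z in
    [/\ X x, lev (g (x, y)) 0, lev 0 u &
        ((f (x, y))%:E <= lagrange_value_fun f g x u)%E]].

Definition K_l f g x y : set 'rV[R]_p :=
  [set u | [/\ lev (g (x, y)) 0, lev 0 u &
               ((f (x, y))%:E <= lagrange_value_fun f g x u)%E]].

Definition linearized_cone g x y : set 'rV[R]_m :=
  [set d | forall i, g (x, y) 0 i = 0 ->
             dot (gradient (fun y' => g (x, y') 0 i) y) d <= 0].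

Definition GCQ g x y : Prop :=
  tangent_cone (lower_feasible g x) y = linearized_cone g x y.

End Bilevel.

(* Main.v *)
Require Import Defs.
From mathcomp Require Import all_boot all_order all_algebra.
From mathcomp Require Import all_classical all_reals all_analysis.
From mathcomp Require Import ring lra.

Set Implicit Arguments.
Unset Strict Implicit.
Unset Printing Implicit Defensive.

Import Order.TTheory GRing.Theory Num.Theory.
Import numFieldNormedType.Exports.

Local Open Scope classical_set_scope.
Local Open Scope ring_scope.

(** Projecting away u maps the feasible set of (LD) into the feasible set of
    (OBOP): weak duality bounds the Lagrange value function by the lower-level
    value function, so f(x, y) <= psi_l(x, u) forces y to solve the lower-level
    problem.  Since F does not see u, this gives (a).

    For (b) the projection has to be onto: every y in Psi(x) must carry some u
    with f(x, y) <= psi_l(x, u) ([strong_duality]).  The vector u is a KKT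
    multiplier.  A minimizer y of f(x, .) over the lower-level feasible set
    satisfies grad f . d >= 0 for every tangent direction d
    ([tangent_gradient_ge0]).  Under GCQ the tangent directions are exactly
    those cut out by the active constraint gradients, so Farkas' lemma
    ([farkas]) writes - grad f as a nonnegative combination of these gradients
    ([kkt_multiplier]).  By convexity a point where the Lagrangian is stationary
    minimizes it globally, and complementarity identifies the minimum with
    f(x, y).

    The gradient inequality of convex functions ([convex_gradient_le]) is used
    twice: for the global minimality, and in the tangent cone argument, where
    applying it at the nearby feasible points and passing to the limit replaces
    a first-order expansion at y. *)

(** * Farkas' lemma *)

(** The induction is Bartl's: if the first k inequalities do not suffice, a
    point x where they hold but b is positive must have a_k(x) > 0.  Projecting
    along x onto the kernel of a_k makes the last inequality void, the induction
    hypothesis applies to the projected functionals, and the coefficient of a_k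
    is recovered by evaluating at x. *)
Lemma farkas (F : realFieldType) (V : lmodType F) (k : nat)
    (a : 'I_k -> V -> F) (b : V -> F) :
    (forall i, scalar (a i)) -> scalar b ->
    (forall v, (forall i, a i v <= 0) -> b v <= 0) ->
  exists u : 'I_k -> F,
    (forall i, 0 <= u i) /\ forall v, b v = \sum_i u i * a i v.
Proof.
elim: k => [|k IH] in a b * => lina linb ab.
  exists (fun=> 0); split=> [[]//|v]; rewrite big_ord0.
  have b_le0 w : b w <= 0 by apply: ab; case.
  apply/eqP; rewrite eq_le b_le0 /= -oppr_le0.
  (* - b v is the value of b at - v, hence nonpositive as well. *)
  suff -> : - b v = b (-1 *: v + (-1 *: v + v)) by [].
  by rewrite !linb; ring.
pose a_ i := a (lift ord_max i); pose aN := a ord_max.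
have splitP (P : 'I_k.+1 -> Prop) :
    (forall i, P (lift ord_max i)) -> P ord_max -> forall i, P i.
  by move=> Pw Pm i; case: (unliftP ord_max i) => [j ->|->].
have sumE u w v : \sum_i (if unlift ord_max i is Some j then u j else w) * a i v
    = \sum_i u i * a_ i v + w * aN v.
  rewrite big_ord_recr /= unlift_none; congr (_ + _).
  apply: eq_bigr => i _.
  have -> : widen_ord (leqnSn k) i = lift ord_max i.
    by apply: ord_inj; rewrite lift_max.
  by rewrite liftK.
have [ab'|] := pselect (forall v, (forall i, a_ i v <= 0) -> b v <= 0).
  have [u [u0 ub]] := IH a_ b (fun i => lina _) linb ab'.
  exists (fun i => if unlift ord_max i is Some j then u j else 0); split.
    by move=> i; case: unlift.
  by move=> v; rewrite sumE mul0r addr0.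
move=> /existsNP[x] /not_implyP[ax /negP]; rewrite -ltNge => bx.
have aNx : 0 < aN x.
  rewrite ltNge; apply/negP => aNx.
  by have := ab x (splitP (fun i => a i x <= 0) ax aNx); rewrite leNgt bx.
(* P h is h composed with the projection v |-> v - c(v) x onto ker aN. *)
pose c (v : V) := aN v / aN x.
pose P (h : V -> F) v := h v - c v * h x.
have PE h v : scalar h -> P h v = h (- c v *: x + v).
  by move=> linh; rewrite linh /P; ring.
have linP h : scalar h -> scalar (P h).
  by move=> linh s v w; rewrite /P /c linh /aN lina; ring.
have [v Pv|u [u0 ub]] := IH (fun i => P (a_ i)) (P b)
    (fun i => linP _ (lina _)) (linP _ linb).
  rewrite PE //; apply: ab; apply: splitP => [i|].
    by have := Pv i; rewrite PE; last exact: lina.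
  by rewrite -/aN -PE; [rewrite /P /c divfK ?subrr ?gt_eqF | exact: lina].
(* uN makes the two sides of the claim agree at x; ax and bx give its sign. *)
pose uN := (b x - \sum_i u i * a_ i x) / aN x.
exists (fun i => if unlift ord_max i is Some j then u j else uN); split.
  move=> i; case: unlift => // ; rewrite divr_ge0 ?(ltW aNx) // subr_ge0.
  apply: le_trans (ltW bx); apply: sumr_le0 => i' _.
  exact: mulr_ge0_le0.
move=> v; rewrite sumE.
have -> : b v = P b v + c v * b x by rewrite /P; ring.
rewrite ub /P; under eq_bigr do rewrite mulrBr.
rewrite sumrB.
have -> : \sum_i u i * (c v * a_ i x) = c v * \sum_i u i * a_ i x.
  by rewrite mulr_sumr; apply: eq_bigr => i _; ring.
by rewrite /uN /c; ring.
Qed.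

(** * Gradients of convex functions *)

Section Gradients.
Context {R : realType}.

Lemma dot_scalar k (v : 'rV[R]_k) : scalar (dot v).
Proof.
move=> c w w'; rewrite /dot mulr_sumr -big_split /=.
by apply: eq_bigr => i _; rewrite !mxE; ring.
Qed.

Lemma dotZr k (v w : 'rV[R]_k) c : dot v (c *: w) = c * dot v w.
Proof. by rewrite /dot mulr_sumr; apply: eq_bigr => i _; rewrite mxE; ring. Qed.

Lemma derive_gradient k (h : 'rV[R]_k -> R) (y v : 'rV[R]_k) :
  differentiable h y -> 'D_v h y = dot (gradient h y) v.
Proof.
move=> dh; rewrite deriveE // {1}(row_sum_delta v) linear_sum /=.
by apply: eq_bigr => i _; rewrite linearZ mxE deriveE //= mulrC.
Qed.

(** Convexity bounds each difference quotient (h(y + t(z - y)) - h(y)) / t with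
    0 < t <= 1 by h(z) - h(y); the derivative is the limit as t -> 0+. *)
Lemma convex_gradient_le k (h : 'rV[R]_k -> R) (y z : 'rV[R]_k) :
    @convex_function R 'rV[R]_k setT h -> differentiable h y ->
  h y + dot (gradient h y) (z - y) <= h z.
Proof.
move=> hcvx dh; rewrite -derive_gradient // -lerBrDl.
have hdrv : cvg (_ @ _) := @diff_derivable _ _ _ _ _ (z - y) dh.
rewrite /derive cvg_at_rightE //.
apply: limr_le.
  rewrite -(cvg_at_rightE (fun t : R => t^-1 *: (_ - h y))) //.
  apply: cvg_trans hdrv; apply: cvg_app.
  by move=> A [e e0 Ae]; exists e => // t te t0; apply: Ae => //;
    exact: lt0r_neq0.
near=> t.
have t0 : 0 < t by near: t; exact: nbhs_right_gt.
have t1 : t <= 1 by near: t; apply: nbhs_right_le.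
pose t01 : {i01 R} := Itv01 (ltW t0) t1.
have ht : h (t *: z + (1 - t) *: y) <= t * h z + (1 - t) * h y.
  exact: (hcvx t01 z y (mem_set I) (mem_set I)).
rewrite [t^-1 *: _]mulrC ler_pdivrMr //=.
have -> : t *: (z - y) + y = t *: z + (1 - t) *: y.
  by rewrite scalerBr scalerBl scale1r -addrA [- _ + y]addrC.
lra.
Unshelve. all: by end_near.
Qed.

(** At a point z of A the gradient inequality and the minimality of y give
    grad h(z) . (z - y) >= h(z) - h(y) >= 0.  Taking z along a sequence that
    defines d and dividing by the step sizes, continuity of the gradient carries
    the sign over to the limit. *)
Lemma tangent_gradient_ge0 k (h : 'rV[R]_k -> R) (A : set 'rV[R]_k) y d :
    @convex_function R 'rV[R]_k setT h -> (forall z, differentiable h z) ->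
    (forall j, {for y, continuous (fun z => gradient h z 0 j)}) ->
    (forall z, A z -> h y <= h z) ->
  tangent_cone A y d -> 0 <= dot (gradient h y) d.
Proof.
move=> hcvx dh cgrad ymin [ys [t [Ays ysy _ dsd]]].
pose ds i := (t i)^-1 *: (ys i - y).
have slope_cvg :
    dot (gradient h (ys i)) (ds i) @[i --> \oo] --> dot (gradient h y) d.
  apply: cvg_big => [|j _]; first exact: add_continuous.
  apply: cvgM.
    exact: (cvg_comp ys (fun z => gradient h z 0 j) ysy (cgrad j)).
  exact: (cvg_comp ds (fun z : 'rV[R]_k => z 0 j) dsd
    (@coord_continuous R 1 k 0 j d)).
rewrite -(cvg_lim _ slope_cvg) //; apply: limr_ge; first exact: cvgP slope_cvg.
apply: nearW => i; have [Ayi ti] := Ays i.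
have := le_trans (convex_gradient_le y hcvx (dh (ys i))) (ymin _ Ayi).
rewrite gerDl => slope_le0.
have -> : ds i = - (t i)^-1 *: (y - ys i).
  by rewrite /ds scaleNr -scalerN opprB.
rewrite dotZr.
by rewrite mulNr oppr_ge0 mulr_ge0_le0 // invr_ge0 ltW.
Qed.

End Gradients.

(** * Freezing the upper-level variable *)

Section Slices.
Context {R : realType} {n m : nat} (W : normedModType R).
Implicit Types (h : 'rV[R]_n * 'rV[R]_m -> W) (x : 'rV[R]_n) (y : 'rV[R]_m).

Lemma differentiable_slice h x y :
  differentiable h (x, y) -> differentiable (fun z => h (x, z)) y.
Proof.
by move=> dh; apply: (@differentiable_comp _ _ _ _ (fun z => (x, z)) h).
Qed.

Lemma derive_slice h x y v : 'D_v (fun z => h (x, z)) y = 'D_(0, v) h (x, y).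
Proof.
rewrite /derive; set q1 := (fun t : R => _); set q2 := (fun t : R => _).
suff -> : q1 = q2 by [].
apply/funext => t; rewrite /q1 /q2 /=; congr (_ *: (h (_, _) - _)).
have -> : (t *: (0 : 'rV[R]_n, v)).1 = 0 by exact: scaler0.
by rewrite add0r.
Qed.

End Slices.

(** * Lagrangian duality for the lower-level problem *)

Section LowerLevel.
Context {R : realType} {n m p : nat}.
Context {f : 'rV[R]_n * 'rV[R]_m -> R} {g : 'rV[R]_n * 'rV[R]_m -> 'rV[R]_p}.
Implicit Types (x : 'rV[R]_n) (y : 'rV[R]_m) (u : 'rV[R]_p).

Lemma solution_map_min x y z :
  solution_map f g x y -> lower_feasible g x z -> f (x, y) <= f (x, z).
Proof.
move=> [_ yval] gz; rewrite -lee_fin; apply: le_trans yval _.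
by apply: ereal_inf_lbound; exists z.
Qed.

Lemma weak_duality x u :
  (lagrange_value_fun f g x u <= value_fun f g x)%E.
Proof.
rewrite /lagrange_value_fun; case: asboolP => [u0|_]; last exact: leNye.
apply: le_ereal_inf_tmp => _ [z gz <-].
apply: ge_ereal_inf; exists (lagrangian f g x z u)%:E; first by exists z.
rewrite lee_fin /lagrangian gerDl; apply: sumr_le0 => i _.
by apply: mulr_ge0_le0; [have := u0 i | have := gz i]; rewrite mxE.
Qed.

(** GCQ turns the geometric optimality condition on the tangent cone into an
    implication between finitely many linear inequalities, to which Farkas'
    lemma applies. *)
Lemma kkt_multiplier x y :
    @convex_function R 'rV[R]_m setT (fun z => f (x, z)) ->
    class_C 2 f -> GCQ g x y -> solution_map f g x y ->
  exists u, [/\ lev 0 u, forall i, u 0 i * g (x, y) 0 i = 0 &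
    forall v, dot (gradient (fun z => f (x, z)) y) v +
      \sum_i u 0 i * dot (gradient (fun z => g (x, z) 0 i) y) v = 0].
Proof.
move=> fcvx [df C1f] gcq ysol.
have fgrad_cont j :
    {for y, continuous (fun z => gradient (fun z' => f (x, z')) z 0 j)}.
  rewrite (_ : (fun z => _) = fun z => 'D_(0, delta_mx 0 j) f (x, z)); last first.
    by apply/funext => z; rewrite mxE derive_slice.
  apply: differentiable_continuous.
  apply: (differentiable_slice (h := 'D_(0, delta_mx 0 j) f)).
  exact: (C1f _).1.
(* Inactive constraints enter as zero functionals, which keeps the index set
   'I_p; their multipliers are reset to 0 below for complementarity. *)
pose a i v := if g (x, y) 0 i == 0
  then dot (gradient (fun z => g (x, z) 0 i) y) v else 0.
have lina i : scalar (a i).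
  rewrite /a => c v w; case: eqP => _; first exact: dot_scalar.
  by rewrite mulr0 addr0.
pose b v := - dot (gradient (fun z => f (x, z)) y) v.
have linb : scalar b by move=> c v w; rewrite /b dot_scalar; ring.
have [v av|u [u0 fu]] := farkas lina linb.
  rewrite oppr_le0.
  apply: (tangent_gradient_ge0 (A := lower_feasible g x)) => //.
  - by move=> z; apply: differentiable_slice.
  - by move=> z; apply: solution_map_min.
  rewrite gcq => i gi0; have := av i; by rewrite /a gi0 eqxx.
exists (\row_i if g (x, y) 0 i == 0 then u i else 0); split.
- by move=> i; rewrite !mxE; case: ifP.
- by move=> i; rewrite mxE; case: eqP => [->|_]; rewrite ?mulr0 ?mul0r.
move=> v; rewrite -[X in X + _]opprK -/(b v) fu addrC; apply/eqP; rewrite subr_eq0.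
apply/eqP/eq_bigr => i _; rewrite mxE /a; case: ifP => // _.
by rewrite mul0r mulr0.
Qed.

(** Adding the gradient inequalities at y of f and of the g_i, weighted by the
    KKT multiplier, bounds the Lagrangian below by f(x, y): the first-order terms
    cancel by stationarity and the constraint terms by complementarity. *)
Lemma strong_duality x y :
    class_C 2 f -> class_C 2 g ->
    @convex_function R 'rV[R]_m setT (fun z => f (x, z)) ->
    (forall i, @convex_function R 'rV[R]_m setT (fun z => g (x, z) 0 i)) ->
    GCQ g x y -> solution_map f g x y ->
  K_l f g x y !=set0.
Proof.
move=> f_C2 g_C2 fcvx gcvx gcq ysol.
have [u [u0 compl stat]] := kkt_multiplier fcvx f_C2 gcq ysol.
exists u; split=> //; first by case: ysol.
rewrite /lagrange_value_fun; case: asboolP => // _.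
apply: le_ereal_inf_tmp => _ [z _ <-]; rewrite lee_fin /lagrangian.
have dg i : differentiable (fun z => g (x, z) 0 i) y.
  apply: (@differentiable_comp _ _ _ _ (fun z => g (x, z)) (fun w => w 0 i)).
    by apply: differentiable_slice; exact: g_C2.1.
  exact: differentiable_coord.
have df : differentiable (fun z => f (x, z)) y.
  by apply: differentiable_slice; exact: f_C2.1.
apply: le_trans (lerD (convex_gradient_le z fcvx df) (lexx _)).
rewrite -addrA lerDl -(stat (z - y)) lerD2l; apply: ler_sum => i _.
rewrite -[X in X <= _]add0r -(compl i) -mulrDr; apply: ler_wpM2l.
  by have := u0 i; rewrite mxE.
exact: convex_gradient_le.
Qed.

End LowerLevel.

(** * The bilevel problem and its dual reformulation *)

Theorem theorem4p2 (R : realType) (n m p : nat)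
    (f F : 'rV[R]_n * 'rV[R]_m -> R)
    (g : 'rV[R]_n * 'rV[R]_m -> 'rV[R]_p)
    (X : set 'rV[R]_n)
    (f_C2 : class_C 2 f) (g_C2 : class_C 2 g) (F_C1 : class_C 1 F)
    (X_neq0 : X !=set0) (X_closed : closed X)
    (f_convex : forall x, X x ->
      @convex_function R 'rV[R]_m setT (fun y => f (x, y)))
    (g_convex : forall x, X x -> forall i : 'I_p,
      @convex_function R 'rV[R]_m setT (fun y => g (x, y) 0 i)) :
  (forall (xbar : 'rV[R]_n) (ybar : 'rV[R]_m),
     global_minimizer F (OBOP_feasible f g X) (xbar, ybar) ->
     forall ubar : 'rV[R]_p, K_l f g xbar ybar ubar ->
     global_minimizer (fun z : 'rV[R]_n * 'rV[R]_m * 'rV[R]_p => F z.1)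
       (LD_feasible f g X) (xbar, ybar, ubar))
  /\
  (forall (xbar : 'rV[R]_n) (ybar : 'rV[R]_m) (ubar : 'rV[R]_p),
     global_minimizer (fun z : 'rV[R]_n * 'rV[R]_m * 'rV[R]_p => F z.1)
       (LD_feasible f g X) (xbar, ybar, ubar) ->
     (forall x, (X `&` dom_solution_map f g) x ->
        forall y, solution_map f g x y -> GCQ g x y) ->
     global_minimizer F (OBOP_feasible f g X) (xbar, ybar)).
Proof.
(* (a) relaxes feasibility by weak duality; (b) lifts a competitor (x, y) by a
   multiplier u, which leaves the objective unchanged. *)
split=> [xb yb [[Xx ysol] bmin] ub [gx u0 le_psi]|
        xb yb ub [[/= Xx gx u0 le_psi] bmin] gcq].
  split=> [|[[x y] u] [Xx' gy u0' le_psi']]; first by split.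
  apply: (bmin (x, y)); split=> //; split=> //.
  exact: le_trans le_psi' (weak_duality _ _).
split; first by split=> //; split=> //; exact: le_trans le_psi (weak_duality _ _).
move=> [x y] [/= Xx' ysol].
have xgcq : GCQ g x y by apply: (gcq x _ y ysol); split=> //; exists y.
have [u [gy u0' le_psi']] :=
  strong_duality f_C2 g_C2 (f_convex _ Xx') (g_convex _ Xx') xgcq ysol.
exact: (bmin (x, y, u) (And4 Xx' gy u0' le_psi')).
Qed.
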